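(* Let $T$ be an unbounded, locally finite metric space with root $o$. The topological space $(\mathscr{C}(L^\infty),d_e)$: (a) is not Hausdorff; (b) is strongly locally compact (and thus locally compact), but not compact; (c) is locally path-connected (and thus locally connected), but not connected or path-connected (i.e. it is neither connected nor path-connected); (d) contains no isolated points.
   Context: A metric space $(T,d)$ with a distinguished point $o$ (the root) is locally finite if for every $M>0$ the set $\{v\in T : d(o,v)<M\}$ is finite; it is unbounded if for every $M>0$ there is $v\in T$ with $d(o,v)\ge M$. $L^\infty=L^\infty(T)$ is the Banach space of bounded functions $f:T\to\mathbb{C}$ with norm $\|f\|_\infty=\sup_{v\in T}|f(v)|$. A self-map of $T$ is an arbitrary function $\varphi:T\to T$; the composition operator is $C_\varphi f=f\circ\varphi$, a bounded linear operator on $L^\infty(T)$. $\mathscr{C}(L^\infty)$ is the set of all composition operators on $L^\infty(T)$. The essential norm of a bounded operator $A$ on $L^\infty(T)$ is $\|A\|_e=\inf\{\|A-K\| : K \text{ compact on } L^\infty(T)\}$, and $d_e(x,y)=\|x-y\|_e$ is a pseudo-metric; $(\mathscr{C}(L^\infty),d_e)$ carries the pseudo-metric topology (open balls form a basis), called the essential norm topology. Conventions (compactness does not presuppose Hausdorff): a space is locally compact if every point has a compact neighborhood; strongly locally compact if every point has a closed compact neighborhood; locally connected if every point has a connected neighborhood; locally path-connected if every point has a path-connected neighborhood. *)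

(* Defs.v *)
From HB Require Import structures.
From mathcomp Require Import all_boot all_order all_algebra.
From mathcomp Require Import complex.
From mathcomp Require Import all_classical all_reals all_analysis.

Set Implicit Arguments.
Unset Strict Implicit.
Unset Printing Implicit Defensive.

Import Order.TTheory GRing.Theory Num.Theory.
Import numFieldNormedType.Exports.

Local Open Scope classical_set_scope.
Local Open Scope ring_scope.
Local Open Scope complex_scope.

(* The norm of a [normedModType R[i]] takes its values in [R[i]]; these values
   are nonnegative, hence real, so taking the real part loses nothing. *)
Definition rnorm (R : realType) (V : normedModType R[i]) (x : V) : R :=
  complex.Re `|x|.

Section rnorm.
Variables (R : realType) (V : normedModType R[i]).
Implicit Types x y : V.

Lemma rnormE x : (rnorm x)%:C = `|x|.
Proof. by rewrite /rnorm RRe_real// realE normr_ge0. Qed.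

Lemma rnorm_ge0 x : 0 <= rnorm x.
Proof. by rewrite -lecR rnormE normr_ge0. Qed.

Lemma rnormD x y : rnorm (x + y) <= rnorm x + rnorm y.
Proof. by rewrite -lecR rmorphD/= !rnormE ler_normD. Qed.

Lemma rnormN x : rnorm (- x) = rnorm x.
Proof. by rewrite /rnorm normrN. Qed.

Lemma rnorm0 : rnorm (0 : V) = 0.
Proof. by rewrite /rnorm normr0. Qed.

Lemma rnormZ (a : R[i]) x : rnorm (a *: x) = rnorm (a : R[i]^o) * rnorm x.
Proof. by apply: (@complexI R); rewrite rmorphM/= !rnormE normrZ. Qed.

Lemma rnorm_eq0 x : rnorm x = 0 -> x = 0.
Proof. by move=> x0; apply: normr0_eq0; rewrite -rnormE x0. Qed.

End rnorm.

Section operators.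
Variables (R : realType) (V : normedModType R[i]).
Implicit Types A B K : V -> V.

Definition bounded_operator A :=
  linear A /\ exists M : R, forall x, rnorm (A x) <= M * rnorm x.

(* [precompact] is the library's notion: contained in a closed compact set. *)
Definition compact_operator K :=
  bounded_operator K /\
  forall B : set V, bounded_set B -> precompact (K @` B).

(* This is the usual norm when A is bounded; [sup] is 0 on unbounded sets. *)
Definition operator_norm A : R :=
  sup [set rnorm (A x) | x in [set x | rnorm x <= 1]].

(* The set below contains the norm of A itself and is bounded below by 0, so
   that [inf] is a genuine infimum: see [has_inf_essential]. *)
Definition essential_norm A : R :=
  inf [set operator_norm (A - K) | K in compact_operator].

Definition essential_dist A B : R := essential_norm (A - B).

Lemma bounded_operator0 : bounded_operator 0.
Proof.
split=> [a x y|].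
  by change (0 = a *: 0 + 0 :> V); rewrite scaler0 addr0.
by exists 0 => x; rewrite mul0r [X in rnorm X](_ : _ = 0)// rnorm0.
Qed.

Lemma bounded_operatorN A : bounded_operator A -> bounded_operator (- A).
Proof.
move=> [lA [M AM]]; split=> [a x y|].
  by rewrite !fctE lA opprD scalerN.
by exists M => x; rewrite !fctE rnormN.
Qed.

Lemma bounded_operatorD A B :
  bounded_operator A -> bounded_operator B -> bounded_operator (A + B).
Proof.
move=> [lA [M AM]] [lB [N BN]]; split=> [a x y|].
  by rewrite !fctE lA lB scalerDr addrACA.
exists (M + N) => x; rewrite !fctE mulrDl (le_trans (rnormD _ _))//.
by rewrite lerD.
Qed.

Lemma operator_norm_ge0 A : 0 <= operator_norm A.
Proof.
have [hA|hA] := pselect (has_sup [set rnorm (A x) | x in [set x | rnorm x <= 1]]).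
  apply: (@le_trans _ _ (rnorm (A 0))); first exact: rnorm_ge0.
  by apply: sup_upper_bound => //; exists 0 => //=; rewrite rnorm0.
by rewrite /operator_norm sup_out.
Qed.

Lemma operator_norm_ub A x : bounded_operator A -> rnorm x <= 1 ->
  rnorm (A x) <= operator_norm A.
Proof.
move=> [_ [M AM]] x1; apply: sup_upper_bound; last by exists x.
split; first by exists (rnorm (A x)); exists x.
exists `|M| => _ [y /= y1 <-]; apply: (le_trans (AM _)).
apply: (le_trans (ler_norm _)); rewrite normrM (ger0_norm (rnorm_ge0 _)).
by rewrite ler_piMr.
Qed.

Lemma operator_normN A : operator_norm (- A) = operator_norm A.
Proof.
rewrite /operator_norm; congr (sup _); apply: eq_imagel => x _.
by rewrite !fctE rnormN.
Qed.

Lemma operator_normD A B : bounded_operator A -> bounded_operator B ->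
  operator_norm (A + B) <= operator_norm A + operator_norm B.
Proof.
move=> bA bB; apply: ge_sup.
  by exists (rnorm ((A + B) 0)); exists 0 => //=; rewrite rnorm0.
move=> _ [x /= x1 <-]; rewrite fctE (le_trans (rnormD _ _))//.
by rewrite lerD// operator_norm_ub.
Qed.

Lemma compact_operator0 : compact_operator 0.
Proof.
split; first exact: bounded_operator0.
move=> B _; apply: (@precompact_subset _ _ [set 0]) => [_ [x _ <-]//|].
rewrite precompact_closed; first exact: compact_set1.
exact/accessible_closed_set1/hausdorff_accessible/norm_hausdorff.
Qed.

Lemma compact_operatorN K : compact_operator K -> compact_operator (- K).
Proof.
move=> [bK cK]; split; first exact: bounded_operatorN.
move=> B /cK; rewrite precompactE => cKB.
have cN : compact (-%R @` closure (K @` B)).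
  by apply: continuous_compact cKB => x; exact/continuous_subspaceT/opp_continuous.
exists (-%R @` closure (K @` B)).
  by move=> _ [x Bx <-]; exists (K x) => //; apply: subset_closure; exists x.
by split => //; apply: compact_closed cN; exact: norm_hausdorff.
Qed.

Lemma compact_operatorD K L :
  compact_operator K -> compact_operator L -> compact_operator (K + L).
Proof.
move=> [bK cK] [bL cL]; split; first exact: bounded_operatorD.
move=> B bB.
have cKB : compact (closure (K @` B)) by rewrite -precompactE; exact: cK.
have cLB : compact (closure (L @` B)) by rewrite -precompactE; exact: cL.
set C := (fun z : V * V => z.1 + z.2) @` (closure (K @` B) `*` closure (L @` B)).
have cC : compact C.
  apply: continuous_compact (compact_setX cKB cLB).
  by apply: continuous_subspaceT => z; exact: add_continuous.
exists C.
  move=> _ [x Bx <-]; exists (K x, L x) => //=.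
  by split => /=; apply: subset_closure; exists x.
by split => //; apply: compact_closed cC; exact: norm_hausdorff.
Qed.

Let ess_set A := [set operator_norm (A - K) | K in compact_operator].

Lemma has_inf_essential A : has_inf (ess_set A).
Proof.
split; first by exists (operator_norm (A - 0)); exists 0 => //; exact: compact_operator0.
by exists 0 => _ [K _ <-]; exact: operator_norm_ge0.
Qed.

Lemma essential_norm_lb A K :
  compact_operator K -> essential_norm A <= operator_norm (A - K).
Proof. by move=> cK; apply: ge_inf; [case: (has_inf_essential A)|exists K]. Qed.

Lemma essential_norm_ge0 A : 0 <= essential_norm A.
Proof.
apply: lb_le_inf; first by case: (has_inf_essential A).
by move=> _ [K _ <-]; exact: operator_norm_ge0.
Qed.

Lemma essential_distxx A : essential_dist A A = 0.
Proof.
apply/eqP; rewrite eq_le essential_norm_ge0 andbT.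
apply: (le_trans (essential_norm_lb _ compact_operator0)).
rewrite subrr subr0 /operator_norm; apply: ge_sup.
  by exists (rnorm (0 : V)); exists 0 => //=; rewrite rnorm0.
by move=> _ [x _ <-]; rewrite [X in rnorm X](_ : _ = 0)// rnorm0.
Qed.

Lemma essential_dist_le_sym A B : essential_dist A B <= essential_dist B A.
Proof.
apply: lb_le_inf; first by case: (has_inf_essential (B - A)).
move=> _ [K cK <-]; rewrite -operator_normN.
rewrite (_ : - (B - A - K) = A - B - - K); last first.
  by apply/funext => x; rewrite !fctE !opprD !opprK (addrC (A x)).
exact/essential_norm_lb/compact_operatorN.
Qed.

Lemma essential_dist_sym A B : essential_dist A B = essential_dist B A.
Proof. by apply/eqP; rewrite eq_le !essential_dist_le_sym. Qed.

Lemma essential_dist_triangle A B C :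
  bounded_operator A -> bounded_operator B -> bounded_operator C ->
  essential_dist A C <= essential_dist A B + essential_dist B C.
Proof.
move=> bA bB bC; apply/ler_addgt0Pl => e e0.
have e20 : 0 < e / 2 by rewrite divr_gt0.
have [_ [K cK <-] Ke] := inf_adherent e20 (has_inf_essential (A - B)).
have [_ [L cL <-] Le] := inf_adherent e20 (has_inf_essential (B - C)).
apply: (@le_trans _ _ (operator_norm (A - C - (K + L)))).
  exact/essential_norm_lb/compact_operatorD.
rewrite (_ : A - C - (K + L) = (A - B - K) + (B - C - L)); last first.
  apply/funext => x; rewrite !fctE [RHS]addrACA opprD; congr (_ + _).
  by rewrite addrA subrK.
apply: (le_trans (operator_normD _ _)).
- by do !apply: bounded_operatorD => //; apply: bounded_operatorN => //; case: cK.
- by do !apply: bounded_operatorD => //; apply: bounded_operatorN => //; case: cL.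
by have := ltW (ltrD Ke Le); rewrite addrACA -splitr [leRHS]addrC.
Qed.

End operators.

Section Linfty.
Variables (R : realType) (T : Type).

(* [^o] selects the structure of normed module of R[i] over itself. *)
Definition bounded_pred : {pred T -> R[i]^o} :=
  [pred f : T -> R[i]^o | `[< bounded_fun f >]].

Record Linfty := MkLinfty {
  Linfty_fun :> T -> R[i]^o ;
  _ : Linfty_fun \in bounded_pred }.

HB.instance Definition _ := [isSub for Linfty_fun].
HB.instance Definition _ := [Choice of Linfty by <:].

Lemma bounded_predP (f : T -> R[i]^o) :
  f \in bounded_pred <-> exists M : R, forall v, rnorm (f v) <= M.
Proof.
split=> [/asboolP[M [Mr fM]]|[M fM]].
  exists (complex.Re M + 1) => v; rewrite -lecR rnormE rmorphD/= RRe_real//.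
  by apply: fM => //; rewrite ltrDl ltr01.
apply/asboolP; exists M%:C; split; first by rewrite complex_real.
by move=> x Mx v _ /=; rewrite -rnormE (le_trans _ (ltW Mx))// lecR.
Qed.

Lemma bounded_pred_submod_closed : submod_closed bounded_pred.
Proof.
split=> [|a f g /bounded_predP[M fM] /bounded_predP[N gN]]; apply/bounded_predP.
  by exists 0 => v; rewrite [X in rnorm X](_ : _ = 0)// rnorm0.
exists (rnorm (a : R[i]^o) * M + N) => v; rewrite !fctE.
by rewrite (le_trans (rnormD _ _))// lerD// rnormZ ler_wpM2l// rnorm_ge0.
Qed.

HB.instance Definition _ := GRing.isSubmodClosed.Build R[i] (T -> R[i]^o)
  bounded_pred bounded_pred_submod_closed.
HB.instance Definition _ := [SubChoice_isSubLmodule of Linfty by <:].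

Let bound_set (f : Linfty) := [set rnorm (f v) | v in [set: T]].

Lemma Linfty_has_ubound (f : Linfty) : has_ubound (bound_set f).
Proof.
by have /bounded_predP[M fM] := valP f; exists M => _ [v _ <-]; exact: fM.
Qed.

Definition sup_norm (f : Linfty) : R := sup [set rnorm (f v) | v in [set: T]].

Lemma sup_norm_ub (f : Linfty) v : rnorm (f v) <= sup_norm f.
Proof. by apply: ub_le_sup; [exact: Linfty_has_ubound|exists v]. Qed.

Lemma sup_norm_ge0 (f : Linfty) : 0 <= sup_norm f.
Proof.
case: (pselect (bound_set f !=set0)) => [[r [v _ _]]|/nonemptyPn f0].
  exact: le_trans (rnorm_ge0 (f v)) (sup_norm_ub f v).
by rewrite /sup_norm [X in sup X]f0 sup0.
Qed.

Lemma sup_norm_le (f : Linfty) (M : R) :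
  0 <= M -> (forall v, rnorm (f v) <= M) -> sup_norm f <= M.
Proof.
move=> M0 fM.
case: (pselect (bound_set f !=set0)) => [fn0|/nonemptyPn f0].
  by apply: ge_sup => // _ [v _ <-].
by rewrite /sup_norm [X in sup X]f0 sup0.
Qed.

Let sup_normD (f g : Linfty) :
  (sup_norm (f + g))%:C <= (sup_norm f)%:C + (sup_norm g)%:C.
Proof.
rewrite -rmorphD lecR sup_norm_le ?addr_ge0 ?sup_norm_ge0// => v.
by rewrite (le_trans (rnormD _ _))// lerD// sup_norm_ub.
Qed.

Let sup_norm_leZ (a : R[i]) (f : Linfty) :
  sup_norm (a *: f) <= rnorm (a : R[i]^o) * sup_norm f.
Proof.
apply: sup_norm_le => [|v]; first by rewrite mulr_ge0 ?rnorm_ge0 ?sup_norm_ge0.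
by rewrite [X in rnorm X](_ : _ = a *: f v)// rnormZ ler_wpM2l ?rnorm_ge0 ?sup_norm_ub.
Qed.

Let sup_normZ (a : R[i]) (f : Linfty) :
  (sup_norm (a *: f))%:C = `|a| * (sup_norm f)%:C.
Proof.
rewrite -[`|a|]/(`|a : R[i]^o|) -rnormE -rmorphM; congr (_%:C).
apply/eqP; rewrite eq_le sup_norm_leZ/=.
have [->|a0] := eqVneq a 0; first by rewrite rnorm0 mul0r sup_norm_ge0.
have ra0 : 0 < rnorm (a : R[i]^o).
  by rewrite lt0r rnorm_ge0 andbT; apply: contra_neq a0 => /rnorm_eq0.
rewrite -ler_pdivlMl//; have := sup_norm_leZ a^-1 (a *: f).
rewrite scalerA mulVf// scale1r => /le_trans; apply.
rewrite (_ : rnorm _ = (rnorm (a : R[i]^o))^-1)//.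
by apply: (@complexI R); rewrite fmorphV/= !rnormE normfV.
Qed.

Let sup_norm_eq0 (f : Linfty) : (sup_norm f)%:C = 0 -> f = 0.
Proof.
move=> /(@complexI R _ 0) f0; apply/val_inj/funext => v /=.
apply/rnorm_eq0/eqP.
by rewrite eq_le rnorm_ge0 andbT -f0 sup_norm_ub.
Qed.

HB.instance Definition _ :=
  Lmodule_isNormed.Build R[i] Linfty sup_normD sup_normZ sup_norm_eq0.

Lemma rnorm_Linfty (f : Linfty) :
  rnorm f = sup [set rnorm (f v) | v in [set: T]].
Proof. by []. Qed.

Lemma bounded_pred_comp (phi : T -> T) (f : Linfty) : f \o phi \in bounded_pred.
Proof.
by apply/bounded_predP; exists (sup_norm f) => v; exact: sup_norm_ub.
Qed.

Definition composition_operator (phi : T -> T) (f : Linfty) : Linfty :=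
  MkLinfty (bounded_pred_comp phi f).

Lemma composition_operator_bounded (phi : T -> T) :
  bounded_operator (composition_operator phi).
Proof.
split=> [a f g|]; first exact/val_inj.
exists 1 => f; rewrite mul1r; apply: sup_norm_le => [|v].
  exact: sup_norm_ge0.
exact: (sup_norm_ub f (phi v)).
Qed.

(* Only the operator is recorded, not a symbol phi inducing it, so that two
   elements are equal exactly when they are the same operator. *)
Record composition_operators := MkCompositionOperator {
  operator_of :> Linfty -> Linfty ;
  _ : exists phi, operator_of = composition_operator phi }.

Lemma operator_of_bounded (A : composition_operators) : bounded_operator A.
Proof. by case: A => A /= [phi ->]; exact: composition_operator_bounded. Qed.

End Linfty.

Section essential_norm_topology.
Variables (R : realType) (T : Type).
Let M := composition_operators R T.

Let ess_ball (A : M) (e : R) : set M := [set B : M | essential_dist A B < e].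
Let ent : set_system (M * M) := entourage_ ess_ball.

HB.instance Definition _ := gen_eqMixin (composition_operators R T).
HB.instance Definition _ := gen_choiceMixin (composition_operators R T).
HB.instance Definition _ := hasNbhs.Build (composition_operators R T) (nbhs_ ent).

Let ess_ball_center (A : M) (e : R) : 0 < e -> ess_ball A e A.
Proof. by move=> e0; rewrite /ess_ball/= essential_distxx. Qed.

Let ess_ball_sym (A B : M) (e : R) : ess_ball A e B -> ess_ball B e A.
Proof. by rewrite /ess_ball/= essential_dist_sym. Qed.

Let ess_ball_triangle (A B C : M) (e1 e2 : R) :
  ess_ball A e1 B -> ess_ball B e2 C -> ess_ball A (e1 + e2) C.
Proof.
move=> AB BC; apply: le_lt_trans (ltrD AB BC).
by apply: essential_dist_triangle; exact: operator_of_bounded.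
Qed.

(* The topology whose neighborhoods of A are the supersets of open d_e-balls
   centered at A. *)
HB.instance Definition _ := @Nbhs_isPseudoMetric.Build R
  (composition_operators R T) ent erefl ess_ball
  ess_ball_center ess_ball_sym ess_ball_triangle erefl.

Lemma ball_essential_dist (A B : composition_operators R T) (e : R) :
  ball A e B = (essential_dist A B < e).
Proof. by []. Qed.

End essential_norm_topology.

Section rooted_metric_space.
Variables (R : realType) (T : metricType R).

Definition locally_finite (o : T) :=
  forall M : R, 0 < M -> finite_set [set v | mdist o v < M].

Definition unbounded (o : T) :=
  forall M : R, 0 < M -> exists v, M <= mdist o v.

End rooted_metric_space.

Section local_properties.
Variable X : topologicalType.

(* The library's [locally_compact] asks for a closed compact neighborhood, which
   differs from the following in spaces that are not Hausdorff. *)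
Definition weakly_locally_compact :=
  forall x : X, exists2 V, nbhs x V & compact V.

Definition strongly_locally_compact :=
  forall x : X, exists V, [/\ nbhs x V, closed V & compact V].

(* One connected neighborhood of each point is required, not a basis of them. *)
Definition locally_connected :=
  forall x : X, exists2 V, nbhs x V & connected V.

Definition path_connected (R : realType) (A : set X) :=
  forall x y, A x -> A y -> exists g : R -> X,
    [/\ {within `[0, 1], continuous g}, g 0 = x, g 1 = y & g @` `[0, 1] `<=` A].

Definition locally_path_connected (R : realType) :=
  forall x : X, exists2 V, nbhs x V & path_connected R V.

End local_properties.

(* Main.v *)
Require Import Defs.
From mathcomp Require Import all_boot all_order all_algebra.
From mathcomp Require Import complex.
From mathcomp Require Import lra.
From mathcomp Require Import all_classical all_reals all_analysis.

(** The essential distance between two composition operators is either [0] or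
    at least [1 / 2], and the whole theorem is a consequence of this gap.

    To see the gap, let [D] be the set of points where the symbols [phi] and
    [psi] differ. If [phi] and [psi] both take finitely many values on [D], then
    [C_phi - C_psi] only looks at finitely many values of its argument; it is a
    finite sum of rank one operators, hence compact, and the distance is [0]
    ([essential_dist_composition_eq0]). Otherwise one of them, say [phi], takes
    infinitely many values [t_0, t_1, ...] on [D]. The indicators of the points
    [t_n] lie in the unit ball, and their images under [C_phi - C_psi] are at
    mutual distance at least [1]. A compact operator maps two of them almost to
    the same place, so it cannot be closer than [1 / 2] to [C_phi - C_psi]
    ([essential_norm_ge_separated], [essential_dist_composition_ge]).

    In a pseudometric space with such a gap ([gapped]) the balls of radius
    [1 / 2] are the classes of the relation of being at distance [0]. They form
    a partition into open and closed sets, each of them carrying the indiscrete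
    topology. An indiscrete set is compact, connected and path-connected
    (any function into it is continuous), so the space has all the local
    properties; on the other hand a connected set stays inside one class, and a
    compact set meets finitely many classes.

    It remains to count. Since [T] is unbounded, it is infinite. A class is
    never a singleton, because changing a symbol at one point gives a different
    operator at distance [0] ([composition_point_twin]): the space is not
    Hausdorff and has no isolated point. There are infinitely many classes,
    because the shifts [t_n |-> t_(n + k)] along a sequence of distinct points
    are pairwise at positive distance ([composition_points_separated]): the
    space is neither compact nor connected nor path-connected. *)

Set Implicit Arguments.
Unset Strict Implicit.
Unset Printing Implicit Defensive.

Import Order.TTheory GRing.Theory Num.Theory.
Import numFieldNormedType.Exports.

Local Open Scope classical_set_scope.
Local Open Scope ring_scope.
Local Open Scope complex_scope.

(** * Sequences in infinite and in compact sets *)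

Lemma infinite_set_inj_seq (X : Type) (A : set X) :
  infinite_set A -> exists2 u : nat -> X, injective u & forall n, A (u n).
Proof.
move=> iA; have [a Aa] : A !=set0.
  by apply/set0P/eqP => A0; apply: iA; rewrite A0.
have /infiniteP/card_leP[f] := iA.
have inT (n : nat) : n \in [set: nat] by rewrite inE.
exists (fun n => val (f (SigSub (inT n)))) => [m n|n].
  by move=> /val_inj/(@inj _ _ _ f); rewrite !inE => /(_ I I) /(congr1 val).
by have := valP (f (SigSub (inT n))); rewrite inE.
Qed.

Lemma infinite_range (Y : Type) (u : nat -> Y) (A : set Y) :
  injective u -> (forall n, A (u n)) -> infinite_set A.
Proof.
move=> uinj Au fA; apply: infinite_nat.
rewrite (_ : [set: nat] = u @^-1` A); last first.
  by apply/seteqP; split => n // _; exact: Au.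
by apply: finite_preimage fA => m n _ _; exact: uinj.
Qed.

(** A sequence in a compact set may have no convergent subsequence, but each
    neighborhood of a cluster point is visited infinitely often. This is enough
    to find two terms of the sequence that are close to each other. *)
Lemma compact_seq_cluster (X : topologicalType) (A : set X) (u : nat -> X) :
  compact A -> (forall n, A (u n)) ->
  exists2 y, A y &
    forall U, nbhs y U -> forall N, exists2 n, (N <= n)%N & U (u n).
Proof.
move=> cA Au.
have [|y [Ay cy]] := cA (u @ \oo) _; first by exists 0%N => // n _; exact: Au.
exists y => // U yU N.
have uN : (u @ \oo) [set u n | n in [set n | (N <= n)%N]].
  by exists N => // n /= Nn; exists n.
by have [_ [[n Nn <-] Un]] := cy _ _ uN yU; exists n.
Qed.

(** * Pseudometric spaces whose small balls are indiscrete *)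

(** All distances smaller than [r] are in fact [0]: the balls of radius [r] are
    the classes of the relation of being at distance [0]. *)
Definition gapped (R : realType) (X : pseudoMetricType R) (r : R) :=
  0 < r /\ forall x y : X, ball x r y -> forall e, 0 < e -> ball x e y.

Section gapped.
Variables (R : realType) (X : pseudoMetricType R) (r : R).
Hypothesis gapX : gapped X r.

(** Points of the same class have the same neighborhoods; the topological
    properties of the classes all come from here. *)
Lemma gapped_ball_nbhs (x y z : X) U :
  ball x r y -> ball x r z -> nbhs y U -> U z.
Proof.
case: gapX => _ gap xy xz /nbhs_ballP[e /= e0]; apply.
have e2 : 0 < e / 2 by rewrite divr_gt0.
rewrite [e]splitr; apply: (@ball_triangle _ _ x).
  by apply: ball_sym; exact: gap.
exact: gap.
Qed.

Lemma gapped_nbhs_ball (x : X) : nbhs x (ball x r).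
Proof. by apply: nbhsx_ballx; case: gapX. Qed.

Lemma gapped_ball_open (x : X) : open (ball x r).
Proof.
rewrite openE => y xy.
apply/nbhs_ballP; exists r; first by case: gapX.
move=> z yz; have [r0 gap] := gapX.
rewrite [r]splitr; apply: (@ball_triangle _ _ y); apply: gap => //.
  by rewrite divr_gt0.
by rewrite divr_gt0.
Qed.

Lemma gapped_ball_closed (x : X) : closed (ball x r).
Proof.
move=> y /(_ _ (gapped_nbhs_ball y))[z [xz yz]]; have [r0 gap] := gapX.
have r2 : 0 < r / 2 by rewrite divr_gt0.
rewrite [r]splitr; apply: (@ball_triangle _ _ z); first exact: gap.
by apply: ball_sym; exact: gap.
Qed.

Lemma gapped_ball_compact (x : X) : compact (ball x r).
Proof.
move=> F PF Fx; exists x; split; first exact/ballxx/(proj1 gapX).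
move=> A B FA xB; have [y [Ay xy]] := filter_ex (filterI FA Fx).
exists y; split => //; apply: (gapped_ball_nbhs _ xy xB).
exact/ballxx/(proj1 gapX).
Qed.

Lemma gapped_ball_connected (x : X) : connected (ball x r).
Proof.
move=> B [b Bb] [C oC BE] _; rewrite BE; apply/seteqP; split => [z []//|z xz].
split=> //; move: Bb; rewrite BE => -[xb Cb].
by apply: (gapped_ball_nbhs xb xz); exact: open_nbhs_nbhs.
Qed.

(** A function with values in one class is continuous, even one that jumps from
    [y] to [z]. *)
Lemma gapped_ball_path_connected (x : X) : path_connected R (ball x r).
Proof.
move=> y z xy xz; pose g (t : R) := if t == 0 then y else z.
have gx t : ball x r (g t) by rewrite /g; case: ifP.
exists g; split.
- apply: continuous_subspaceT => t U gU.
  apply/nbhs_ballP; exists 1 => //= s _.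
  exact: (gapped_ball_nbhs (gx t) (gx s) gU).
- by rewrite /g eqxx.
- by rewrite /g oner_eq0.
- by move=> _ [t _ <-].
Qed.

(** A class is open and closed, so it cuts a connected set in two pieces one of
    which is empty. *)
Lemma gapped_connected_subset_ball (x : X) (A : set X) :
  connected A -> A x -> A `<=` ball x r.
Proof.
move=> cA Ax y Ay; suff AE : A `&` ball x r = A by move: Ay; rewrite -AE => -[].
have := @cA (A `&` ball x r); apply.
- by exists x; split => //; exact/ballxx/(proj1 gapX).
- by exists (ball x r) => //; exact: gapped_ball_open.
- by exists (ball x r) => //; exact: gapped_ball_closed.
Qed.

Lemma gapped_strongly_locally_compact : strongly_locally_compact X.
Proof.
move=> x; exists (ball x r); split.
- exact: gapped_nbhs_ball.
- exact: gapped_ball_closed.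
- exact: gapped_ball_compact.
Qed.

Lemma gapped_locally_connected : locally_connected X.
Proof.
move=> x; exists (ball x r); first exact: gapped_nbhs_ball.
exact: gapped_ball_connected.
Qed.

Lemma gapped_locally_path_connected : locally_path_connected X R.
Proof.
move=> x; exists (ball x r); first exact: gapped_nbhs_ball.
exact: gapped_ball_path_connected.
Qed.

(** A cluster point of [u] would have two terms of [u] in its class. *)
Lemma gapped_not_compact (u : nat -> X) :
  (forall m n, m != n -> ~ ball (u m) r (u n)) -> ~ compact [set: X].
Proof.
move=> sep cX; have [//|y _ uy] := @compact_seq_cluster _ _ u cX _.
have [m _ ym] := uy _ (gapped_nbhs_ball y) 0%N.
have [n mn yn] := uy _ (gapped_nbhs_ball y) m.+1.
apply: (sep m n); first by rewrite ltn_eqF.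
by apply: (gapped_ball_nbhs ym yn); exact: gapped_nbhs_ball.
Qed.

Lemma gapped_not_connected (x y : X) :
  ~ ball x r y -> ~ connected [set: X].
Proof. by move=> xy /gapped_connected_subset_ball/(_ I y I)/xy. Qed.

Lemma gapped_not_path_connected (x y : X) :
  ~ ball x r y -> ~ path_connected R [set: X].
Proof.
move=> xy /(_ x y I I)[g [cg g0 g1 _]]; apply: xy.
have cI : connected (g @` `[0, 1]).
  by apply: connected_continuous_connected cg; exact: segment_connected.
apply: (gapped_connected_subset_ball cI).
- by exists 0 => //; rewrite /= in_itv/= lexx ler01.
- by exists 1 => //; rewrite /= in_itv/= lexx ler01.
Qed.

End gapped.

(** * Compact operators and the essential norm *)

Section compact_operators.
Variables (R : realType) (V : normedModType R[i]).

Lemma rnormB_sym (x y : V) : rnorm (x - y) = rnorm (y - x).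
Proof. by rewrite -rnormN opprB. Qed.

Lemma ball_rnormE (x y : V) (e : R) :
  ball x e%:C y <-> rnorm (x - y) < e.
Proof. by rewrite -ball_normE/= -ltcR rnormE. Qed.

(** A compact operator cannot separate the terms of a sequence in the unit
    ball: their images cluster somewhere. *)
Lemma compact_operator_near_pair (K : V -> V) (u : nat -> V) (e : R) :
  compact_operator K -> (forall n, rnorm (u n) <= 1) -> 0 < e ->
  exists m n, m != n /\ rnorm (K (u m) - K (u n)) < e.
Proof.
move=> [_ cK] u1 e0.
have bB : bounded_set [set x : V | rnorm x <= 1].
  exists 1; split; first exact: real1.
  move=> M M1 x /= x1; apply: le_trans (ltW M1).
  by rewrite -rnormE -[1]/(1%:C) lecR.
have := cK _ bB; rewrite precompactE => cKB.
have [|y _ uy] := @compact_seq_cluster _ _ (K \o u) cKB _.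
  by move=> n; apply: subset_closure; exists (u n) => //; exact: u1.
have yU : nbhs y (ball y (e / 2)%:C).
  by apply: nbhsx_ballx; rewrite ltcR divr_gt0.
have [m _ /ball_rnormE ym] := uy _ yU 0%N.
have [n mn /ball_rnormE yn] := uy _ yU m.+1.
exists m, n; split; first by rewrite ltn_eqF.
rewrite -(subrKA y) (le_lt_trans (rnormD _ _))//.
by rewrite rnormB_sym [e]splitr ltrD.
Qed.

(** If [K] is compact and [A - K] has norm [N], two vectors [u_m], [u_n] with
    [K u_m] and [K u_n] almost equal have images under [A] at distance at most
    [2 N], up to an arbitrarily small error. Hence [c <= 2 N]. *)
Lemma essential_norm_ge_separated (A : V -> V) (u : nat -> V) (c : R) :
  bounded_operator A -> (forall n, rnorm (u n) <= 1) ->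
  (forall m n, m != n -> c <= rnorm (A (u m) - A (u n))) ->
  c / 2 <= essential_norm A.
Proof.
move=> bA u1 sep; rewrite leNgt; apply/negP; rewrite -subr_gt0 => lt.
have [_ [K cK <-]] := inf_adherent lt (has_inf_essential A).
rewrite -/(essential_norm A) subrKC => Kc.
have e0 : 0 < c - operator_norm (A - K) *+ 2 by rewrite mulr2n; lra.
have [m [n [mn]]] := compact_operator_near_pair cK u1 e0.
apply/negP; rewrite -leNgt.
have bAK : bounded_operator (A - K).
  by apply: bounded_operatorD => //; apply: bounded_operatorN; case: cK.
have AKE : A (u m) - A (u n) =
    (A - K) (u m) - (A - K) (u n) + (K (u m) - K (u n)).
  by rewrite addrACA -opprD !fctE !subrK.
have := sep _ _ mn; rewrite AKE => /le_trans/(_ (rnormD _ _)).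
move=> /le_trans/(_ (lerD (rnormD _ _) (lexx _))); rewrite rnormN.
have := operator_norm_ub bAK (u1 m); have := operator_norm_ub bAK (u1 n).
by rewrite mulr2n; lra.
Qed.

End compact_operators.

(** * Differences of composition operators *)

Section rank_one.
Variables (R : realType) (V : normedModType R[i]).

Lemma bounded_set_rnorm (B : set V) :
  bounded_set B -> exists M : R, forall x, B x -> rnorm x <= M.
Proof.
move=> [M [Mr BM]]; exists (complex.Re M + 1) => x Bx.
rewrite -lecR rnormE rmorphD/= RRe_real//.
by apply: BM => //; rewrite ltrDl ltr01.
Qed.

(** The complex line spanned by [g] is the real span of [g] and ['i *: g], hence
    a continuous image of the real plane, where closed squares are compact. *)
Lemma continuous_scale_real (g : V) : continuous (fun x : R => x%:C *: g).
Proof.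
move=> x; have g1 : 0 < rnorm g + 1 by rewrite ltr_wpDl// rnorm_ge0.
apply/cvg_ballP => e e0.
have er : e = (complex.Re e)%:C by rewrite RRe_real// gtr0_real.
rewrite er in e0 *; move: (complex.Re e) e0 => {er}e; rewrite (ltcR 0) => e0.
apply/nbhs_ballP; exists (e / (rnorm g + 1)); first by rewrite /= divr_gt0.
move=> y; rewrite /ball/= => xy; apply/ball_rnormE.
rewrite -scalerBl -rmorphB rnormZ.
have -> : rnorm ((x - y)%:C : R[i]^o) = `|x - y|.
  by apply: (@complexI R); rewrite rnormE normc_def/= expr0n addr0 sqrtr_sqr.
apply: (@le_lt_trans _ _ (`|x - y| * (rnorm g + 1))).
  by rewrite ler_wpM2l// lerDl.
by rewrite -ltr_pdivlMr.
Qed.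

(** The image of a bounded set consists of multiples of [g] by bounded complex
    scalars [x + 'i y], and [(x, y)] stays in a square of the real plane. *)
Lemma compact_operator_rank_one (l : V -> R[i]^o) (g : V) :
  linear l -> (exists M : R, forall x, rnorm (l x) <= M * rnorm x) ->
  compact_operator (fun x => (l x : R[i]) *: g).
Proof.
move=> ll [M lM]; split.
  split=> [a x y|]; first by rewrite ll scalerDl scalerA.
  by exists (M * rnorm g) => x; rewrite rnormZ mulrAC ler_wpM2r// rnorm_ge0.
move=> B /bounded_set_rnorm[N BN]; pose I := [set` `[- (`|M| * N), `|M| * N]].
pose h (p : R * R) : V := p.1%:C *: g + p.2%:C *: ('i%C *: g).
have cI : compact (h @` (I `*` I)).
  apply: continuous_compact; last exact: compact_setX (@segment_compact _ _ _)
    (@segment_compact _ _ _).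
  apply: continuous_subspaceT => p; apply: (@continuousD _ _ _
    (fun p : R * R => p.1%:C *: g) (fun p : R * R => p.2%:C *: ('i%C *: g))).
  - exact: (continuous_comp cvg_fst (continuous_scale_real (g := g) (x := _))).
  - exact: (continuous_comp cvg_snd (continuous_scale_real (x := _))).
exists (h @` (I `*` I)).
  move=> _ [x Bx <-].
  have lx : rnorm (l x) <= `|M| * N.
    apply: (le_trans (lM x)); apply: (@le_trans _ _ (`|M| * rnorm x)).
      by rewrite ler_wpM2r ?rnorm_ge0// ler_norm.
    by rewrite ler_wpM2l// BN.
  have inI y : `|y| <= rnorm (l x) -> I y.
    by move=> /le_trans/(_ lx); rewrite ler_norml /I/= in_itv.
  exists (complex.Re (l x), complex.Im (l x)).
    split; apply: inI; rewrite -lecR rnormE.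
    - exact: normc_ge_Re.
    - by rewrite normc_def lecR -sqrtr_sqr ler_wsqrtr// lerDr sqr_ge0.
  by rewrite /h/= scalerA -scalerDl [_ * 'i%C]mulrC -complexE.
by split=> //; apply: compact_closed cI; exact: norm_hausdorff.
Qed.

End rank_one.

Lemma compact_operator_sum (R : realType) (V : normedModType R[i]) (I : Type)
    (s : seq I) (F : I -> V -> V) :
  (forall i, compact_operator (F i)) -> compact_operator (\sum_(i <- s) F i).
Proof.
move=> cF; apply: big_ind => [|K L|i _]; last exact: cF.
- exact: compact_operator0.
- exact: compact_operatorD.
Qed.

Section composition_operators.
Variables (R : realType) (T : choiceType).
Implicit Types (phi psi : T -> T) (E : set T) (f : Linfty R T).

Lemma indicator_bounded E :
  (fun v => (v \in E)%:R : R[i]^o) \in @bounded_pred R T.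
Proof.
apply/bounded_predP; exists 1 => v; rewrite -lecR rnormE.
by rewrite normr_nat -[1%:C]/(1 : R[i]) lern1 leq_b1.
Qed.

Definition indicator E : Linfty R T := MkLinfty (indicator_bounded E).

Lemma rnorm_indicator E : rnorm (indicator E) <= 1.
Proof.
apply: sup_norm_le => // v.
by rewrite -lecR rnormE normr_nat -[1%:C]/(1 : R[i]) lern1 leq_b1.
Qed.

Local Notation C := (@composition_operator R T).

Lemma composition_operator_inj : injective C.
Proof.
move=> phi psi CE; apply/funext => v.
have /(congr1 (fun g : Linfty R T => g v))/= :
  C phi (indicator [set phi v]) = C psi (indicator [set phi v]) by rewrite CE.
rewrite /= !in_set1 eqxx.
have [->//|_ /eqP] := eqVneq (psi v) (phi v).
by rewrite oner_eq0.
Qed.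

Definition differing phi psi := [set v | phi v <> psi v].

(** Let [E_p] be the set of points [v] with [(phi v, psi v) = p]. Then
    [C_phi f - C_psi f] is the sum over [p] of the rank one terms
    [(f p.1 - f p.2) *: 1_(E_p)]. Only the pairs with distinct components
    contribute, and there are finitely many of them. *)
Lemma compact_composition_sub phi psi :
  finite_set (phi @` differing phi psi) ->
  finite_set (psi @` differing phi psi) ->
  compact_operator (C phi - C psi).
Proof.
move=> fphi fpsi; set D := differing phi psi in fphi fpsi.
pose P := (fun v => (phi v, psi v)) @` D.
have : finite_set P.
  apply: (@sub_finite_set _ _ ((phi @` D) `*` (psi @` D))).
    by move=> _ [v Dv <-]; split; exists v.
  exact: finite_setX.
move=> /finite_seqP[s0 Ps0]; pose s := undup s0.
pose E (p : T * T) := indicator [set v | (phi v, psi v) = p].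
pose F (p : T * T) (f : Linfty R T) : Linfty R T :=
  (f p.1 - f p.2 : R[i]) *: E p.
suff -> : C phi - C psi = \sum_(p <- s) F p.
  apply: compact_operator_sum => p; apply: compact_operator_rank_one.
    move=> a f g /=; rewrite scalerBr !opprD !addrA; congr (_ - _).
    by rewrite addrAC.
  exists 2 => f; rewrite (le_trans (rnormD _ _))// rnormN mulr_natl mulr2n.
  by rewrite lerD// (sup_norm_ub f).
apply/funext => f; rewrite fct_sumE; apply/val_inj/funext => v /=.
rewrite [RHS](big_morph (fun g : Linfty R T => g v) (fun _ _ => erefl) erefl).
have FE p : F p f v = if p == (phi v, psi v) then f p.1 - f p.2 else 0.
  rewrite [LHS](_ : _ =
    (f p.1 - f p.2 : R[i]) * (v \in [set v | (phi v, psi v) = p])%:R)//.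
  case: eqVneq => [->|/eqP pN]; first by rewrite mem_set// mulr1.
  by rewrite memNset ?mulr0// => /esym.
rewrite (eq_bigr _ (fun p _ => FE p)).
(* At [v] only the term of index [(phi v, psi v)] can be nonzero; when this
   index is missing from [s], the two symbols agree at [v]. *)
have [Es|Es] := boolP ((phi v, psi v) \in s).
  rewrite (bigD1_seq _ Es) ?undup_uniq//= eqxx/= big1 ?addr0// => p pN.
  by rewrite (negPf pN).
rewrite big_seq big1 => [|p ps].
  have [vE|/eqP vD] := eqVneq (phi v) (psi v).
    by rewrite [LHS](_ : _ = f (phi v) - f (psi v))// vE subrr.
  case/negP: Es; rewrite mem_undup.
  by have : P (phi v, psi v) by [exists v]; rewrite Ps0.
by case: eqP => // pE; move: Es; rewrite -pE ps.
Qed.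

Lemma essential_dist_composition_eq0 phi psi :
  finite_set (phi @` differing phi psi) ->
  finite_set (psi @` differing phi psi) ->
  essential_dist (C phi) (C psi) = 0.
Proof.
move=> fphi fpsi; apply/eqP; rewrite eq_le essential_norm_ge0 andbT.
apply: le_trans (essential_norm_lb _ (compact_composition_sub fphi fpsi)) _.
rewrite subrr; apply: ge_sup => [|_ [f _ <-]]; last by rewrite rnorm0.
by exists (rnorm (0 : Linfty R T)); exists 0 => //=; rewrite rnorm0.
Qed.

(** If [v] is a point with [phi v = t_m] and [psi v <> t_m], then
    [C_phi - C_psi] maps [1_(t_m) - 1_(t_n)] to a function whose value at [v] is
    [2] if [psi v = t_n], and [1] otherwise. *)
Lemma essential_dist_composition_ge phi psi :
  infinite_set (phi @` differing phi psi) ->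
  1 / 2 <= essential_dist (C phi) (C psi).
Proof.
move=> /infinite_set_inj_seq[t tinj tD].
apply: (@essential_norm_ge_separated _ _ _ (fun n => indicator [set t n])).
- apply: bounded_operatorD; first exact: composition_operator_bounded.
  exact/bounded_operatorN/composition_operator_bounded.
- by move=> n; exact: rnorm_indicator.
move=> m n mn; have [v vD vm] := tD m.
apply: le_trans (sup_norm_ub _ v).
pose b : bool := psi v \in [set t n].
have -> : ((C phi - C psi) (indicator [set t m]) -
    (C phi - C psi) (indicator [set t n])) v = (1 + b%:R)%:C.
  rewrite [LHS](_ : _ = (phi v \in [set t m])%:R - (psi v \in [set t m])%:R -
    ((phi v \in [set t n])%:R - (psi v \in [set t n])%:R))//.
  rewrite -/b vm mem_set// memNset; last by rewrite -vm => /esym.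
  rewrite memNset; last by move=> /tinj/eqP; rewrite (negPf mn).
  by rewrite subr0 sub0r opprK rmorphD/= rmorph_nat.
by rewrite -lecR rnormE ger0_norm ?lecR ?lerDl.
Qed.

End composition_operators.

(** * The space of composition operators *)

Definition composition_point (R : realType) (T : Type) (phi : T -> T) :
    composition_operators R T :=
  MkCompositionOperator (ex_intro _ phi erefl).

Section composition_space.
Variables (R : realType) (T : choiceType).
Local Notation X := (composition_operators R T).
Local Notation C := (@composition_point R T).

Lemma composition_pointP (A : X) : exists phi, A = C phi.
Proof.
case: A => A hA; case: (hA) => phi Aphi; subst A; exists phi.
by congr MkCompositionOperator; exact: Prop_irrelevance.
Qed.

(** At a distance smaller than [1 / 2] both symbols take finitely many values
    where they differ, by the lower bound applied to the two orders of the
    symbols, and then the difference is compact. *)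
Lemma gapped_composition_operators : gapped X (1 / 2 : R).
Proof.
split; first by rewrite divr_gt0.
move=> A B; have [phi ->] := composition_pointP A.
have [psi ->] := composition_pointP B.
have differingC : differing psi phi = differing phi psi.
  by apply/seteqP; split => v vN /esym.
rewrite ball_essential_dist => lt e e0; rewrite ball_essential_dist.
rewrite (essential_dist_composition_eq0 R)//.
  apply: contrapT => /(essential_dist_composition_ge R)/le_lt_trans/(_ lt).
  by rewrite ltxx.
apply: contrapT; rewrite -differingC => /(essential_dist_composition_ge R).
by rewrite essential_dist_sym => /le_lt_trans/(_ lt); rewrite ltxx.
Qed.

(** Changing a symbol at the single point [a] does not change the class of the
    operator. *)
Lemma composition_point_twin (a b : T) : a <> b ->
  forall A : X, exists2 B : X, A <> B & ball A (1 / 2 : R) B.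
Proof.
move=> ab A; have [phi ->] := composition_pointP A.
have [c phic] : exists c, phi a <> c.
  by have [phia|] := pselect (phi a = a); [exists b; rewrite phia|exists a].
pose psi v := if v == a then c else phi v.
have psia : psi a = c by rewrite /psi eqxx.
have Da : differing phi psi `<=` [set a].
  by move=> v; rewrite /differing /psi/=; case: eqVneq.
have fD : finite_set (differing phi psi).
  exact: sub_finite_set Da (finite_set1 a).
exists (C psi).
  move=> /(congr1 (@operator_of R T))/composition_operator_inj/(congr1 (@^~ a)).
  by rewrite /= psia.
rewrite ball_essential_dist (essential_dist_composition_eq0 R).
- by rewrite divr_gt0.
- exact: finite_image.
- exact: finite_image.
Qed.

(** The shifts [t_n |-> t_(n + k)] differ pairwise at every [t_n], and each of
    them takes infinitely many values there. *)
Lemma composition_points_separated : infinite_set [set: T] ->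
  exists u : nat -> X, forall m n, m != n -> ~ ball (u m) (1 / 2 : R) (u n).
Proof.
move=> /infinite_set_inj_seq[t tinj _].
(* A left inverse of [t], extending the shifts to all of [T]. *)
pose s v := xget 0%N [set n | t n = v].
have sK n : s (t n) = n.
  by apply: tinj; apply: (@xgetPex _ 0%N [set k | t k = t n]); exists n.
pose phi k v := t (s v + k)%N.
exists (C \o phi) => m n mn; rewrite ball_essential_dist.
apply/negP; rewrite -leNgt; apply: essential_dist_composition_ge.
apply: (@infinite_range _ (fun k => t (k + m)%N)).
  by move=> i j /tinj/addIn.
move=> k; exists (t k); last by rewrite /phi sK.
by move=> /tinj/addnI/eqP; rewrite (negPf mn).
Qed.

End composition_space.

Lemma unbounded_infinite (R : realType) (T : metricType R) (o : T) :
  unbounded o -> infinite_set [set: T].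
Proof.
move=> uo /finite_seqP[s Ts].
pose M := \big[Order.max/0]_(v <- s) mdist o v.
have le_M v : mdist o v <= M.
  by apply: le_bigmax_seq => //; have : [set: T] v by []; rewrite Ts.
have M0 : 0 <= M by apply: le_trans (le_M o); exact: mdist_ge0.
have [|v] := uo (M + 1); first by rewrite ltr_wpDl.
by move=> /le_trans/(_ (le_M v)); rewrite gerDl ler10.
Qed.

Theorem theorem4p15 (R : realType) (T : metricType R) (o : T) :
  locally_finite o -> unbounded o ->
  [/\ ~ hausdorff_space (composition_operators R T),
      [/\ strongly_locally_compact (composition_operators R T),
          weakly_locally_compact (composition_operators R T) &
          ~ compact [set: composition_operators R T]],
      [/\ locally_path_connected (composition_operators R T) R,
          locally_connected (composition_operators R T),
          ~ connected [set: composition_operators R T] &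
          ~ path_connected R [set: composition_operators R T]] &
      isolated [set: composition_operators R T] = set0].
Proof.
move=> _ /unbounded_infinite iT.
have gapX := gapped_composition_operators R T.
have [u sep] := composition_points_separated R iT.
have [t tinj _] := infinite_set_inj_seq iT.
have t01 : t 0%N <> t 1%N by move=> /tinj.
have twin := composition_point_twin (R := R) t01.
split; [|split|split|].
- move=> hX; have [B AB ballAB] := twin (u 0%N).
  apply: AB; apply: hX => U W uU BW; exists (u 0%N); split.
    exact: nbhs_singleton.
  apply: (gapped_ball_nbhs gapX ballAB _ BW).
  exact/ballxx/(proj1 gapX).
- exact: gapped_strongly_locally_compact gapX.
- by move=> A; have [V [AV _ cV]] :=
    gapped_strongly_locally_compact gapX A; exists V.
- exact: (gapped_not_compact gapX sep).
- exact: gapped_locally_path_connected gapX.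
- exact: gapped_locally_connected gapX.
- exact: (gapped_not_connected gapX (sep 0%N 1%N isT)).
- exact: (gapped_not_path_connected gapX (sep 0%N 1%N isT)).
- apply/seteqP; split => // A [_ [U AU]]; rewrite setIT => UA.
  have [B AB ballAB] := twin A; apply: AB.
  have : U B.
    by apply: (gapped_ball_nbhs gapX _ ballAB AU); exact/ballxx/(proj1 gapX).
  by rewrite UA.
Qed.
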